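(* Let Assumption (A1) hold and assume that the linear fusion rule $(\boldsymbol K_1,\boldsymbol K_2,\hat{\boldsymbol P})\colon\mathcal D_F\to\mathbb R^{n\times p_1}\times\mathbb R^{n\times p_2}\times\mathcal P_n^\succ$ is unbiased and preserves conservativeness on $\mathcal P_{p_1+p_2}^\succ$. Then, at every point $(\hat x_1,\hat x_2,\hat P_1,\hat P_2)\in\mathcal D_F$, $$\mathcal E(\hat{\boldsymbol P}^{-1})\supseteq\mathcal E(H_1^\top\hat P_1^{-1}H_1)\cap\mathcal E(H_2^\top\hat P_2^{-1}H_2).$$
   Context: $n,p_1,p_2$ are positive integers, $p_1,p_2\le n$, $H_1\in\mathbb R^{p_1\times n}$, $H_2\in\mathbb R^{p_2\times n}$, $H=\begin{pmatrix}H_1\\H_2\end{pmatrix}$. Assumption (A1): $\mathrm{rk}(H_1)=p_1$, $\mathrm{rk}(H_2)=p_2$, $\mathrm{rk}(H)=n$ (and the two input estimators $\hat x_1,\hat x_2$ are unbiased estimators of $H_1x_{\rm true}$, $H_2x_{\rm true}$; in the deterministic maps only their values enter). $\mathcal P_m,\mathcal P_m^\succ$: real symmetric positive semi-definite, resp. positive definite, $m\times m$ matrices; $\preceq$ is the Löwner order. $\mathcal D_F:=\mathbb R^{p_1}\times\mathbb R^{p_2}\times\mathcal P_{p_1}^\succ\times\mathcal P_{p_2}^\succ$. For $\Sigma\in\mathcal P_n$, $\mathcal E(\Sigma):=\{x\in\mathbb R^n : x^\top\Sigma x\le1\}$. The rule is unbiased if $\boldsymbol K_1H_1+\boldsymbol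 K_2H_2=I$ on $\mathcal D_F$. It preserves conservativeness on $\mathcal P_{p_1+p_2}^\succ$ if for all $(\hat x_1,\hat x_2,\hat P_1,\hat P_2)\in\mathcal D_F$ and all $P_{\rm joint}=\begin{pmatrix}P_1&P_{12}\\P_{12}^\top&P_2\end{pmatrix}\in\mathcal P_{p_1+p_2}^\succ$ with $P_1\preceq\hat P_1$ and $P_2\preceq\hat P_2$ one has $\begin{pmatrix}\boldsymbol K_1&\boldsymbol K_2\end{pmatrix}P_{\rm joint}\begin{pmatrix}\boldsymbol K_1&\boldsymbol K_2\end{pmatrix}^\top\preceq\hat{\boldsymbol P}$ (maps evaluated at that point). *)

(* Defs.v *)
From mathcomp Require Import all_boot all_order all_algebra.
From mathcomp Require Import classical_sets reals.

Set Implicit Arguments.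
Unset Strict Implicit.
Unset Printing Implicit Defensive.

Import Order.TTheory GRing.Theory Num.Theory.
Local Open Scope classical_set_scope.
Local Open Scope ring_scope.

Definition quadform (R : realType) (m : nat) (A : 'M[R]_m) (x : 'cV[R]_m) : R :=
  (x^T *m A *m x) 0 0.

Definition psd_matrices (R : realType) (m : nat) : set 'M[R]_m :=
  [set A | A^T = A /\ forall x : 'cV[R]_m, 0 <= quadform A x].

Definition pd_matrices (R : realType) (m : nat) : set 'M[R]_m :=
  [set A | A^T = A /\ forall x : 'cV[R]_m, x != 0 -> 0 < quadform A x].

Definition loewner_le (R : realType) (m : nat) (A B : 'M[R]_m) : Prop :=
  psd_matrices (B - A).

Definition ellipsoid (R : realType) (m : nat) (S : 'M[R]_m) : set 'cV[R]_m :=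
  [set x | quadform S x <= 1].

(* Ambient type of the tuples (x1, x2, P1, P2) of two estimates and their
   covariance bounds. *)
Definition fusion_input (R : realType) (p1 p2 : nat) : Type :=
  ('cV[R]_p1 * 'cV[R]_p2 * 'M[R]_p1 * 'M[R]_p2)%type.

Definition fusion_domain (R : realType) (p1 p2 : nat) :
    set (fusion_input R p1 p2) :=
  [set d | let: (_, _, P1, P2) := d in pd_matrices P1 /\ pd_matrices P2].

(* The rule fuses (x1, x2) into K1 x1 + K2 x2 with covariance bound Phat.  The
   three maps are total on the ambient type; their values outside
   [fusion_domain] are irrelevant and left unconstrained. *)
Record linear_fusion_rule (R : realType) (n p1 p2 : nat) := LinearFusionRule {
  gain1 : fusion_input R p1 p2 -> 'M[R]_(n, p1);
  gain2 : fusion_input R p1 p2 -> 'M[R]_(n, p2);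
  fused_bound : fusion_input R p1 p2 -> 'M[R]_n;
  fused_bound_pd : forall d, fusion_domain d -> pd_matrices (fused_bound d)
}.

Definition unbiased_rule (R : realType) (n p1 p2 : nat)
    (H1 : 'M[R]_(p1, n)) (H2 : 'M[R]_(p2, n))
    (F : linear_fusion_rule R n p1 p2) : Prop :=
  forall d, fusion_domain d -> gain1 F d *m H1 + gain2 F d *m H2 = 1%:M.

Definition preserves_conservativeness (R : realType) (n p1 p2 : nat)
    (Pset : set 'M[R]_(p1 + p2)) (F : linear_fusion_rule R n p1 p2) : Prop :=
  forall (x1 : 'cV[R]_p1) (x2 : 'cV[R]_p2) (P1hat : 'M[R]_p1) (P2hat : 'M[R]_p2),
  let d := (x1, x2, P1hat, P2hat) in
  fusion_domain d ->
  forall (P1 : 'M[R]_p1) (P12 : 'M[R]_(p1, p2)) (P2 : 'M[R]_p2),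
  let Pjoint := block_mx P1 P12 P12^T P2 in
  Pset Pjoint -> loewner_le P1 P1hat -> loewner_le P2 P2hat ->
  let K := row_mx (gain1 F d) (gain2 F d) in
  loewner_le (K *m Pjoint *m K^T) (fused_bound F d).

(* Main.v *)
Require Import Defs.
From mathcomp Require Import all_boot all_order all_algebra.
From mathcomp Require Import classical_sets reals.
From mathcomp Require Import ring lra.

Set Implicit Arguments.
Unset Strict Implicit.
Unset Printing Implicit Defensive.

Import Order.TTheory GRing.Theory Num.Theory.
Local Open Scope classical_set_scope.
Local Open Scope ring_scope.

(** Fix [x] in both input ellipsoids and put [y_i := H_i x].  A point [y] lies
    in the ellipsoid of [P^-1] exactly when the rank-one matrix [y y^T] is
    Loewner-below [P] ([outer_loewner_leP]), so each [y_i y_i^T] is below the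
    bound [P_i].  Hence the fully correlated joint covariance [y y^T], where [y]
    stacks [y_1] and [y_2], is compatible with both bounds, and unbiasedness
    makes the gain [K] send it to [K y y^T K^T = x x^T].  If conservativeness
    could be used at [y y^T], it would say that [x x^T] is below the fused
    bound, which by the same equivalence is the claim.

    As [y y^T] is singular while conservativeness concerns positive definite
    joint covariances, it is used instead at the convex combinations
    [s y y^T + (1 - s) diag (P_1, P_2)] with [0 <= s < 1].  These are positive
    definite, still respect the bounds, and their images dominate [s x x^T].
    This gives [s q <= 1] for every such [s], where [q] is the value at [x] of
    the quadratic form of the inverse fused bound; therefore [q <= 1]. *)

Section QuadraticForms.
Variable R : realType.

Lemma quadformD m (A B : 'M[R]_m) v :
  quadform (A + B) v = quadform A v + quadform B v.
Proof. by rewrite /quadform mulmxDr mulmxDl mxE. Qed.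

Lemma quadformZ m a (A : 'M[R]_m) v : quadform (a *: A) v = a * quadform A v.
Proof. by rewrite /quadform -scalemxAr -scalemxAl mxE. Qed.

Lemma quadformB m (A B : 'M[R]_m) v :
  quadform (A - B) v = quadform A v - quadform B v.
Proof. by rewrite -scaleN1r quadformD quadformZ mulN1r. Qed.

Lemma quadform0 m (A : 'M[R]_m) : quadform A 0 = 0.
Proof. by rewrite /quadform mulmx0 mxE. Qed.

Lemma quadform_congr m k (A : 'M[R]_m) (K : 'M[R]_(k, m)) v :
  quadform (K *m A *m K^T) v = quadform A (K^T *m v).
Proof. by rewrite /quadform trmx_mul trmxK !mulmxA. Qed.

Lemma quadform_outer m (y v : 'cV[R]_m) :
  quadform (y *m y^T) v = ((v^T *m y) 0 0) ^+ 2.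
Proof.
rewrite /quadform mulmxA -mulmxA mxE big_ord1 expr2; congr (_ * _).
by rewrite -[y^T *m v]trmxK trmx_mul trmxK mxE.
Qed.

Lemma quadform_block_diag m k (A : 'M[R]_m) (B : 'M[R]_k) u v :
  quadform (block_mx A 0 0 B) (col_mx u v) = quadform A u + quadform B v.
Proof.
rewrite /quadform tr_col_mx mul_row_block !mulmx0 addr0 add0r mul_row_col.
by rewrite mxE.
Qed.

Lemma pd_psd m (A : 'M[R]_m) : pd_matrices A -> psd_matrices A.
Proof.
move=> [symA posA]; split=> // v.
by have [->|/posA/ltW //] := eqVneq v 0; rewrite quadform0.
Qed.

Lemma psdZ m a (A : 'M[R]_m) :
  0 <= a -> psd_matrices A -> psd_matrices (a *: A).
Proof.
move=> a_ge0 [symA posA]; split=> [|v]; first by rewrite linearZ /= symA.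
by rewrite quadformZ mulr_ge0.
Qed.

Lemma pdZ m a (A : 'M[R]_m) : 0 < a -> pd_matrices A -> pd_matrices (a *: A).
Proof.
move=> a_gt0 [symA posA]; split=> [|v v_neq0]; first by rewrite linearZ /= symA.
by rewrite quadformZ mulr_gt0 // posA.
Qed.

Lemma psd_pdD m (A B : 'M[R]_m) :
  psd_matrices A -> pd_matrices B -> pd_matrices (A + B).
Proof.
move=> [symA posA] [symB posB]; split=> [|v v_neq0].
  by rewrite linearD /= symA symB.
by rewrite quadformD ltr_wpDl // posB.
Qed.

Lemma psd_outer m (y : 'cV[R]_m) : psd_matrices (y *m y^T).
Proof.
by split=> [|v]; [rewrite trmx_mul trmxK | rewrite quadform_outer sqr_ge0].
Qed.

Lemma pd_block_diag m k (A : 'M[R]_m) (B : 'M[R]_k) :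
  pd_matrices A -> pd_matrices B -> pd_matrices (block_mx A 0 0 B).
Proof.
move=> pdA pdB; have [symA posA] := pdA; have [symB posB] := pdB.
split=> [|v]; first by rewrite tr_block_mx symA symB !trmx0.
rewrite -[v]vsubmxK col_mx_eq0 quadform_block_diag.
have [->|u_neq0] := eqVneq (usubmx v) 0; last first.
  by move=> _; rewrite ltr_pwDl ?posA //; case: (pd_psd pdB).
by rewrite quadform0 add0r => /posB.
Qed.

Lemma pd_unitmx m (A : 'M[R]_m) : pd_matrices A -> A \in unitmx.
Proof.
move=> [_ posA]; rewrite unitmxE unitfE; apply/det0P => -[v v_neq0 vA0].
have /posA : v^T != 0 by rewrite -trmx0 (inj_eq trmx_inj).
by rewrite /quadform trmxK vA0 mul0mx mxE ltxx.
Qed.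

Lemma quadform_invmx m (A : 'M[R]_m) y : pd_matrices A ->
  quadform (invmx A) y = quadform A (invmx A *m y).
Proof.
move=> pdA; have [symA _] := pdA.
rewrite /quadform trmx_mul trmx_inv symA mulmxKV ?pd_unitmx //.
by rewrite mulmxA.
Qed.

(** For the right [r] this completes a square, and stating it for every [r]
    avoids dividing by [quadform (invmx A) y]. *)
Lemma quadform_shift_invmx m (A : 'M[R]_m) (y v : 'cV[R]_m) r :
  pd_matrices A ->
  quadform A (v - r *: (invmx A *m y)) =
  quadform A v - 2 * r * (v^T *m y) 0 0 + r ^+ 2 * quadform (invmx A) y.
Proof.
move=> pdA; have [symA _] := pdA; have unitA := pd_unitmx pdA.
have AKy : A *m (invmx A *m y) = y by rewrite mulKVmx.
have yAv : (invmx A *m y)^T *m A = y^T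
  by rewrite trmx_mul trmx_inv symA mulmxKV.
have yv : (y^T *m v) 0 0 = (v^T *m y) 0 0.
  by rewrite -[y^T *m v]trmxK trmx_mul trmxK mxE.
rewrite quadform_invmx // /quadform [(_ - _)^T]linearB /= [(_ *: _)^T]linearZ /=.
rewrite mulmxBl -scalemxAl yAv mulmxBl !mulmxBr -!scalemxAl -!scalemxAr.
rewrite -(mulmxA v^T A (invmx A *m y)) AKy.
by move: yv; rewrite !mxE => ->; ring.
Qed.

(** A scaled duality between [P^-1] and [P], of Cauchy-Schwarz type: for
    [s = 1] it says that [y] lies in the ellipsoid of [P^-1] iff [y y^T] is
    Loewner-below [P].  The scaling is what survives of the perturbation of
    the singular matrix [y y^T]. *)
Lemma outer_loewner_leP m (P : 'M[R]_m) (y : 'cV[R]_m) s :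
  pd_matrices P -> 0 <= s ->
  loewner_le (s *: (y *m y^T)) P <-> s * quadform (invmx P) y <= 1.
Proof.
move=> pdP s_ge0; have [symP _] := pdP; have [_ psdP] := pd_psd pdP.
split=> [[_ le_yP]|sq_le1]; last first.
  split=> [|v]; first by rewrite linearB linearZ /= trmx_mul trmxK symP.
  rewrite quadformB quadformZ quadform_outer.
  (* The shift by [s * (v^T *m y)] is the minimizer when [s * q = 1]. *)
  have := psdP (v - (s * (v^T *m y) 0 0) *: (invmx P *m y)).
  rewrite quadform_shift_invmx //.
  set a := (v^T *m y) 0 0; set q := quadform (invmx P) y in sq_le1 *.
  have : 0 <= s * a ^+ 2 * (1 - s * q).
    by apply: mulr_ge0; [apply: mulr_ge0; rewrite ?sqr_ge0 | rewrite subr_ge0].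
  by lra.
(* Test the inequality at the direction where Cauchy-Schwarz is an equality. *)
have := le_yP (invmx P *m y); rewrite quadformB quadformZ quadform_outer.
rewrite -quadform_invmx // trmx_mul trmx_inv symP -/(quadform _ _).
have : 0 <= quadform (invmx P) y by rewrite quadform_invmx.
rewrite le_eqVlt => /predU1P[<-|q_gt0]; first by rewrite mulr0.
by rewrite expr2 mulrA -{1}[quadform _ y]mul1r -mulrBl pmulr_lge0 // subr_ge0.
Qed.

Lemma loewner_le_convex m (A B : 'M[R]_m) s : 0 <= s ->
  loewner_le A B -> loewner_le (s *: A + (1 - s) *: B) B.
Proof.
move=> s_ge0 AB; rewrite /loewner_le.
have -> : B - (s *: A + (1 - s) *: B) = s *: (B - A).
  by apply/matrixP => i j; rewrite !mxE; ring.
exact: psdZ.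
Qed.

Lemma loewner_le_addr m (A B C : 'M[R]_m) :
  psd_matrices B -> loewner_le (A + B) C -> loewner_le A C.
Proof.
move=> [symB posB] [symC posC]; rewrite /loewner_le.
have -> : C - A = C - (A + B) + B by rewrite opprD addrA subrK.
split=> [|v]; first by rewrite linearD /= symB symC.
by rewrite quadformD addr_ge0.
Qed.

Lemma psd_congr m k (A : 'M[R]_m) (K : 'M[R]_(k, m)) :
  psd_matrices A -> psd_matrices (K *m A *m K^T).
Proof.
move=> [symA posA]; split=> [|v]; last by rewrite quadform_congr.
by rewrite !trmx_mul trmxK symA mulmxA.
Qed.

Lemma le1_of_scaled (q : R) :
  (forall s, 0 <= s < 1 -> s * q <= 1) -> q <= 1.
Proof.
move=> le_sq; rewrite leNgt; apply/negP => q_gt1.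
have q_gt0 : 0 < q by apply: lt_trans q_gt1.
(* The midpoint of [q^-1] and [1] is a factor that still exceeds [q^-1]. *)
have qV_lt1 : q^-1 < 1 by rewrite invf_lt1.
have qV_gt0 : 0 < q^-1 by rewrite invr_gt0.
have /le_sq : 0 <= (1 + q^-1) / 2 < 1 by apply/andP; split; lra.
by rewrite mulrAC mulrDl mul1r mulVf ?gt_eqF // => ?; lra.
Qed.

(** What conservativeness says about the singular joint covariance [y y^T], for
    [y] the stack of [y1] and [y2]: its admissible perturbation
    [s y y^T + (1 - s) diag (P1, P2)] has image [s z z^T] plus a positive
    semidefinite term, which can be dropped. *)
Lemma conservative_outer_le n p1 p2 (F : linear_fusion_rule R n p1 p2)
    x1 x2 P1 P2 (y1 : 'cV[R]_p1) (y2 : 'cV[R]_p2) s :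
  let d := (x1, x2, P1, P2) in let z := gain1 F d *m y1 + gain2 F d *m y2 in
  preserves_conservativeness (@pd_matrices R (p1 + p2)) F ->
  fusion_domain d -> loewner_le (y1 *m y1^T) P1 -> loewner_le (y2 *m y2^T) P2 ->
  0 <= s < 1 -> loewner_le (s *: (z *m z^T)) (fused_bound F d).
Proof.
move=> d z F_cons dom_d le1 le2 /andP[s_ge0 s_lt1]; have [pd1 pd2] := dom_d.
pose D := block_mx P1 0 0 P2; pose y := col_mx y1 y2.
have pdD : pd_matrices ((1 - s) *: D).
  by apply: pdZ; [rewrite subr_gt0 | apply: pd_block_diag].
have jointE : block_mx (s *: (y1 *m y1^T) + (1 - s) *: P1) (s *: (y1 *m y2^T))
    (s *: (y1 *m y2^T))^T (s *: (y2 *m y2^T) + (1 - s) *: P2)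
    = s *: (y *m y^T) + (1 - s) *: D.
  rewrite tr_col_mx mul_col_row !scale_block_mx add_block_mx !scaler0 !addr0.
  by rewrite linearZ /= trmx_mul trmxK.
have := F_cons x1 x2 P1 P2 dom_d (s *: (y1 *m y1^T) + (1 - s) *: P1)
  (s *: (y1 *m y2^T)) (s *: (y2 *m y2^T) + (1 - s) *: P2).
rewrite -/d /= jointE => /(_ (psd_pdD (psdZ s_ge0 (psd_outer y)) pdD)).
move=> /(_ (loewner_le_convex s_ge0 le1) (loewner_le_convex s_ge0 le2)).
set K := row_mx _ _; have <- : K *m y = z by rewrite mul_row_col.
have -> : K *m (s *: (y *m y^T) + (1 - s) *: D) *m K^T =
    s *: ((K *m y) *m (K *m y)^T) + K *m ((1 - s) *: D) *m K^T.
  by rewrite mulmxDr mulmxDl -scalemxAr -scalemxAl trmx_mul !mulmxA.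
exact/loewner_le_addr/psd_congr/pd_psd.
Qed.

End QuadraticForms.

Theorem theorem14 (R : realType) (n p1 p2 : nat)
    (n_gt0 : (0 < n)%N) (p1_gt0 : (0 < p1)%N) (p2_gt0 : (0 < p2)%N)
    (p1_le_n : (p1 <= n)%N) (p2_le_n : (p2 <= n)%N)
    (H1 : 'M[R]_(p1, n)) (H2 : 'M[R]_(p2, n))
    (rank_H1 : \rank H1 = p1) (rank_H2 : \rank H2 = p2)
    (rank_H : \rank (col_mx H1 H2) = n)
    (F : linear_fusion_rule R n p1 p2)
    (F_unbiased : unbiased_rule H1 H2 F)
    (F_cons : preserves_conservativeness (@pd_matrices R (p1 + p2)) F)
    (x1 : 'cV[R]_p1) (x2 : 'cV[R]_p2) (P1hat : 'M[R]_p1) (P2hat : 'M[R]_p2)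
    (in_domain : fusion_domain (x1, x2, P1hat, P2hat)) :
  ellipsoid (H1^T *m invmx P1hat *m H1) `&` ellipsoid (H2^T *m invmx P2hat *m H2)
    `<=` ellipsoid (invmx (fused_bound F (x1, x2, P1hat, P2hat))).
Proof.
move=> x [x_in1 x_in2]; have [pd1 pd2] := in_domain.
have pdF := fused_bound_pd F in_domain.
have outer_le p (H : 'M[R]_(p, n)) P : pd_matrices P ->
    ellipsoid (H^T *m invmx P *m H) x ->
    loewner_le ((H *m x) *m (H *m x)^T) P.
  move=> pdP; rewrite /ellipsoid /= -{2}[H]trmxK quadform_congr trmxK => x_in.
  by rewrite -[_ *m _^T]scale1r; apply/outer_loewner_leP; rewrite // mul1r.
apply: le1_of_scaled => s s_itv; have /andP[s_ge0 _] := s_itv.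
apply/outer_loewner_leP => //.
have := conservative_outer_le F_cons in_domain (outer_le _ _ _ pd1 x_in1)
  (outer_le _ _ _ pd2 x_in2) s_itv.
by rewrite !mulmxA -mulmxDl F_unbiased // mul1mx.
Qed.
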